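(* Let $V$ be a $\mathbb{Z}_2$-graded Lie algebra (resp. a $\mathbb{Z}_2$-graded associative algebra) over a field $\mathbf{k}$ of characteristic different from $2$, regarded as an $L_\infty$ (resp. $A_\infty$) algebra whose codifferential $d=d_2$ has only a quadratic part. Let $c_i$ and $b_i$ ($i\ge1$) be sequences of cohomology classes of $C(V)$, of bidegrees $(\bar i,i-1)$ and $(\overline{i-1},i-1)$ respectively. Let $$F=\mathrm{span}\{e^{i,j},f^{i,j}\}_{i\ge1,\ i+j\ge2},\qquad F_0=\mathrm{span}\{e^{1,j},f^{1,j}\}_{j\ge1},\qquad F_1=F,$$ with bidegrees $\mathrm{bid}\,e^{i,j}=(\bar j,j-2)$, $\mathrm{bid}\,f^{i,j}=(\overline{j-1},j-2)$, and comultiplication $$\Delta e^{p,q}=-\tfrac12\sum_{i,j}e^{i,j}\otimes e^{p-i,q+2-j},\qquad \Delta f^{p,q}=-\tfrac12\sum_{i,j}\big(f^{i,j}\otimes e^{p-i,q+2-j}+e^{i,j}\otimes f^{p-i,q+2-j}\big),$$ the sums being over all integers $i,j$ with $1\le i\le p-1$, $i+j\ge2$ and $(p-i)+(q+2-j)\ge2$. Let $a\colon F_0\to H$ be the linear map with $a(e^{1,j})=c_j$, $a(f^{1,j})=b_j$, where $H$ is the cohomology of $C(V)$. Then there exists a formal deformation $$d_t=\sum_{i=0}^\infty t^i(\gamma_i+\theta\beta_i),\qquad \gamma_i=\sum_{m=1}^\infty\varphi_{i,m},\quad \beta_i=\sum_{m=1}^\infty\psi_{i,m},$$ of $V$ as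 an $L_\infty$ (resp. $A_\infty$) algebra, with $\varphi_{1,i}\in c_i$ and $\psi_{1,i}\in b_i$ for all $i\ge1$, if and only if $a$ satisfies the condition of triviality of Massey $F$-products.
   Context: **Cochains and brackets.** Inside an exponent of $-1$, a homogeneous element or map stands for its $\mathbb{Z}_2$-degree. $A_\infty$ case: $C^k(V)=\mathrm{Hom}(V^{\otimes k},V)$. For $\varphi\in C^k(V)$, $\psi\in C^l(V)$, $n=k+l-1$, $$[\varphi,\psi](v_1,\dots,v_n)=\sum_{0\le j\le k-1}(-1)^{r}\varphi(v_1,\dots,v_j,\psi(v_{j+1},\dots,v_{j+l}),v_{j+l+1},\dots,v_n)-(-1)^{\varphi\psi+(k-1)(l-1)}\sum_{0\le j\le l-1}(-1)^{s}\psi(v_1,\dots,v_j,\varphi(v_{j+1},\dots,v_{j+k}),v_{j+k+1},\dots,v_n),$$ with $r=\psi(v_1+\cdots+v_j)+j(l-1)$ and $s=\varphi(v_1+\cdots+v_j)+j(k-1)$. $L_\infty$ case: $C^k(V)=\mathrm{Hom}(\bigwedge^kV,V)$, where $\bigwedge$ is the graded exterior power ($v\wedge w=-(-1)^{vw}w\wedge v$). Define $\epsilon(\sigma)=\epsilon(\sigma;v_1,\dots,v_n)$ by $v_1\wedge\cdots\wedge v_n=(-1)^\sigma\epsilon(\sigma)\,v_{\sigma(1)}\wedge\cdots\wedge v_{\sigma(n)}$, with $(-1)^\sigma$ the sign of $\sigma$; $\mathrm{Sh}(p,q)$ is the set of permutations of $\{1,\dots,p+q\}$ increasing on $1,\dots,p$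 and on $p+1,\dots,p+q$. Then $$[\varphi,\psi](v_1,\dots,v_n)=\sum_{\sigma\in \mathrm{Sh}(l,k-1)}(-1)^\sigma\epsilon(\sigma)\,\varphi(\psi(v_{\sigma(1)},\dots,v_{\sigma(l)}),v_{\sigma(l+1)},\dots,v_{\sigma(n)})-(-1)^{\psi\varphi+(k-1)(l-1)}\sum_{\sigma\in \mathrm{Sh}(k,l-1)}(-1)^\sigma\epsilon(\sigma)\,\psi(\varphi(v_{\sigma(1)},\dots,v_{\sigma(k)}),v_{\sigma(k+1)},\dots,v_{\sigma(n)}).$$ In both cases $C(V)$ consists of (possibly infinite) sums of elements of $C^k(V)$, $k\ge1$, with $C^k(V)=0$ for $k\le0$. The bidegree of $\varphi\in C^k(V)$ is $(|\varphi|,k-1)\in\mathbb{Z}_2\times\mathbb{Z}$, and its parity is $|\varphi|+k-1\bmod2$; similarly an element of bidegree $(\bar k,m)$ of any bigraded space has parity $k+m\bmod2$. The modified bracket is $\{\varphi,\psi\}=(-1)^{(k-1)|\psi|}[\varphi,\psi]$ for $\varphi\in C^k(V)$; with respect to the $\mathbb{Z}_2$-grading of $C(V)$ in which $\varphi\in C^k(V)$ has parity $|\varphi|+k-1\bmod2$, $(C(V),\{\cdot,\cdot\})$ is a graded Lie algebra. **Infinity algebras.** An $A_\infty$ (resp. $L_\infty$) structure on $V$ is an odd $d=\sum_kd_k\in C(V)$, $d_k\in C^k(V)$, with $\{d,d\}=0$ ($d$ is called the codifferential); when $d=d_2$ this is an associative (resp. Lie) algebra structure. Put $\delta(\varphi)=\{d,\varphi\}$;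 when $d=d_2$, $\delta$ has bidegree $(\bar0,1)$, so the cohomology $H$ of $C(V)$ with respect to $\delta$ is bigraded. **Formal deformations.** A formal deformation is $d_t=\sum_{i\ge0}t^i(\gamma_i+\theta\beta_i)$ with $\{d_t,d_t\}=0$, where $t$ is an even parameter, $\theta$ an odd parameter with $\theta^2=0$ (the bracket being extended with the usual signs: $\{\theta x,y\}=\theta\{x,y\}$, $\{x,\theta y\}=(-1)^{x}\theta\{x,y\}$ with $(-1)^x$ the sign of the parity of $x$), $\gamma_0=d$, $\beta_0=0$, and $\gamma_i,\beta_i\in C(V)$ decompose as $\gamma_i=\sum_{m\ge1}\varphi_{i,m}$, $\beta_i=\sum_{m\ge1}\psi_{i,m}$ with $\mathrm{bid}(\varphi_{i,m})=(\bar m,m-1)$ and $\mathrm{bid}(\psi_{i,m})=(\overline{m-1},m-1)$. **Triviality of Massey $F$-products.** Let $\mu(u,v)=\{u,v\}$ and let $\pi\colon\ker\delta\to H$ be the projection. A linear map $a\colon F_0\to H$ satisfies the condition of triviality of Massey $F$-products (with $F_1=F$) if there is a linear map $\alpha\colon F\to C(V)$ of degree $1$ (that is, of bidegree $(\bar0,1)$) with $$\delta\circ\alpha=\mu\circ(\alpha\otimes\alpha)\circ\Delta\quad\text{and}\quad\pi\circ\alpha|_{F_0}=a,$$ where $(\alpha\otimes\alpha)(x\otimes y)=(-1)^{x}\alpha(x)\otimes\alpha(y)$, with $(-1)^{x}$ the sign of the parity of $x$. *)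

(* Defs.v *)
From HB Require Import structures.
From mathcomp Require Import all_boot all_order all_fingroup all_algebra.
From mathcomp Require Import generic_quotient ring_quotient.
From mathcomp Require Import boolp functions.
From mathcomp Require Import finmap.
From mathcomp.multinomials Require Import monalg.

(** Conventions (Mathematical Components, with the classical axioms of [boolp]).  Z_2-degrees are booleans (true = odd) added with [(+)].
    A Z_2-graded vector space is a family [V : bool -> lmodType k], and
    [tot V] is the direct sum of its two components. *)

Set Implicit Arguments.
Unset Strict Implicit.
Unset Printing Implicit Defensive.

Import GRing.Theory.
Local Open Scope ring_scope.

Inductive infty_kind := Ainfty | Linfty.

Section GradedSpace.
Variables (k : fieldType) (V : bool -> lmodType k).

Definition tot : lmodType k := (V false * V true)%type.

Definition hpart (b : bool) (w : tot) : tot :=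
  if b then (0, w.2) else (w.1, 0).

Definition homog (b : bool) (w : tot) : Prop := hpart b w = w.

Definition hparts (b : seq bool) (v : seq tot) : seq tot :=
  [seq hpart p.1 p.2 | p <- zip b v].

(** The Z_2-degree of v_1 + ... + v_n, as a natural number to be used as an
    exponent of -1. *)
Definition deg (b : seq bool) : nat := count id b.

End GradedSpace.

Notation precochain V := (bool -> seq (tot V) -> tot V).

Section Cochains.
Variables (kd : infty_kind) (k : fieldType) (V : bool -> lmodType k).
Local Notation W := (tot V).

(** An element x of C(V) = prod_(n >= 1) C^n(V) is given by its bihomogeneous
    components: [x e], restricted to lists of length n, is the component of
    Z_2-degree e in C^n(V), seen as an n-ary map on V.  The fields say that
    there is no component with n = 0, that the components are multilinear,
    that [x e] has Z_2-degree e and, in the L_infty case, that the components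
    factor through the graded exterior power (v /\ w = - (-1)^(vw) w /\ v). *)
Record cochain (x : precochain V) : Prop := Cochain {
  cochain_nil : forall e, x e [::] = 0;
  cochain_lin : forall e s t (a : k) (u v : W),
    x e (s ++ (a *: u + v) :: t) = a *: x e (s ++ u :: t) + x e (s ++ v :: t);
  cochain_deg : forall e (b : seq bool) (v : seq W),
    size b = size v -> hparts b v = v -> homog (e (+) odd (deg b)) (x e v);
  cochain_alt : kd = Linfty -> forall e s t (b c : bool) (u v : W),
    homog b u -> homog c v ->
    x e (s ++ u :: v :: t) = - ((-1) ^+ (b * c)%N *: x e (s ++ v :: u :: t)) }.

Definition cochain_pred : {pred precochain V} := fun x => `[< cochain x >].

Lemma hpart_lin b (a : k) (u v : W) :
  hpart b (a *: u + v) = a *: hpart b u + hpart b v.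
Proof.
by case: b; rewrite /hpart; congr pair; rewrite //= scaler0 addr0.
Qed.

Lemma cochain_submod : submod_closed cochain_pred.
Proof.
split.
  apply/asboolP; split=> //.
  - by move=> e s t a u v; rewrite /GRing.zero /= scaler0 addr0.
  - by move=> e b v _ _; rewrite /homog /hpart; case: ifP.
  - by move=> _ e s t b c u v _ _; rewrite scaler0 oppr0.
move=> a x y /asboolP[x0 xl xd xa] /asboolP[y0 yl yd ya].
have E e v : (a *: x + y) e v = a *: x e v + y e v by [].
apply/asboolP; split.
- by move=> e; rewrite E x0 y0 scaler0 addr0.
- move=> e s t c u v; rewrite !E xl yl !scalerDr !scalerA (mulrC a c).
  by rewrite !addrA; congr (_ + _); rewrite -!addrA; congr (_ + _); rewrite addrC.
- move=> e b v sbv hbv.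
  by rewrite /homog !E hpart_lin (xd _ _ _ sbv hbv) (yd _ _ _ sbv hbv).
- move=> kdL e s t b c u v hu hv.
  rewrite !E (xa kdL _ _ _ _ _ _ _ hu hv) (ya kdL _ _ _ _ _ _ _ hu hv).
  by rewrite scalerN !scalerDr opprD !scalerA mulrC.
Qed.

HB.instance Definition _ :=
  GRing.isSubmodClosed.Build k (precochain V) cochain_pred cochain_submod.

Definition C := {x : precochain V | cochain_pred x}.
HB.instance Definition _ := SubChoice.on C.
HB.instance Definition _ := [SubChoice_isSubLmodule of C by <:].

Definition cval (x : C) : precochain V := val x.

(** x has bidegree (e, m), i.e. x lies in C^(m+1)(V) and has Z_2-degree e;
    for m < 0 this forces x = 0. *)
Definition has_bidegree (x : C) (e : bool) (m : int) : Prop :=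
  forall e' v, ~~ ((e' == e) && ((size v)%:Z - 1 == m)) -> cval x e' v = 0.

(** x = sum_(m >= 1) xs m, where xs m is in C^m(V). *)
Definition is_sum (x : C) (xs : nat -> C) : Prop :=
  forall e v, cval x e v = cval (xs (size v)) e v.

End Cochains.

Coercion cval : C >-> Funclass.

Section Bracket.
Variables (kd : infty_kind) (k : fieldType) (V : bool -> lmodType k).
Local Notation W := (tot V).
Local Notation pre := (precochain V).

(** First sum of the A_infty bracket: f is of arity n, g is of arity l and
    Z_2-degree q, and v = v_1, ..., v_(n+l-1) are of Z_2-degrees b. *)
Definition circA (n l : nat) (q : bool) (f g : seq W -> W)
    (b : seq bool) (v : seq W) : W :=
  \sum_(0 <= j < n) (-1) ^+ (q * deg (take j b) + j * l.-1)%N *: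
    f (take j v ++ g (take l (drop j v)) :: drop (j + l) v).

(** [is_shuffle p s]: s is in Sh(p, N - p). *)
Definition is_shuffle (p N : nat) (s : 'S_N) : bool :=
  [forall i : 'I_N, forall j : 'I_N,
    (i < j)%N && ((j < p)%N || (p <= i)%N) ==> (s i < s j)%N].

(** epsilon(s; v_1, ..., v_N) = (-1)^(koszul s b) for v_i of degree b_i:
    reordering v_1 /\ ... /\ v_N into v_s(1) /\ ... /\ v_s(N) exchanges once
    each pair forming an inversion of s, at the cost of
    - (-1)^(v_s(i) v_s(j)). *)
Definition koszul (N : nat) (s : 'S_N) (b : seq bool) : nat :=
  \sum_(i < N) \sum_(j < N | (i < j)%N && (s j < s i)%N)
    (nth false b (s i) * nth false b (s j))%N.

Definition permute (N : nat) (s : 'S_N) (v : seq W) : seq W :=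
  [seq nth 0 v (s i) | i <- enum 'I_N].

Definition circL (l : nat) (f g : seq W -> W) (b : seq bool) (v : seq W) : W :=
  \sum_(s : 'S_(size v) | is_shuffle l s)
    ((-1) ^+ odd_perm s * (-1) ^+ koszul s b) *:
    f (g (take l (permute s v)) :: drop l (permute s v)).

Definition circ (n l : nat) (q : bool) (f g : seq W -> W) b v : W :=
  match kd with
  | Ainfty => circA n l q f g b v
  | Linfty => circL l f g b v
  end.

(** [f, g](v) for f in C^n(V) of degree p, g in C^l(V) of degree q and v
    homogeneous of degrees b. *)
Definition br_hom (n l : nat) (p q : bool) (f g : seq W -> W) b v : W :=
  circ n l q f g b v
  - (-1) ^+ (p * q + n.-1 * l.-1)%N *: circ l n p g f b v.

(** Extension by multilinearity to arguments that need not be homogeneous. *)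
Definition br_comp (n l : nat) (p q : bool) (f g : seq W -> W) (v : seq W) : W :=
  \sum_(b : (size v).-tuple bool) br_hom n l p q f g b (hparts b v).

(** The modified bracket {x, y}, written as an operation on all families of
    maps; it restricts to C(V).  On lists of length N, the component of degree
    e collects the {x_(n,p), y_(l,q)} with n + l - 1 = N and p + q = e. *)
Definition mu (x y : pre) : pre := fun e v =>
  let N := size v in
  \sum_(1 <= n < N.+1) \sum_(p : bool)
    let l := (N.+1 - n)%N in let q := p (+) e in
    (-1) ^+ (n.-1 * q)%N *: br_comp n l p q (x p) (y q) v.

(** The parity e + n - 1 mod 2 of the bidegree (e, n - 1), and the operator
    x |-> (-1)^x x. *)
Definition parity (e : bool) (n : nat) : bool := e (+) odd n.-1.

Definition sign_op (x : pre) : pre := fun e v =>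
  (-1) ^+ parity e (size v) *: x e v.

End Bracket.

Section InfinityAlgebra.
Variables (kd : infty_kind) (k : fieldType) (V : bool -> lmodType k).
Local Notation CV := (C kd V).

Definition infty_structure (d : CV) : Prop :=
  (forall e v, ~~ parity e (size v) -> d e v = 0) /\ mu kd d d = 0.

(** d = d_2, i.e. d is the structure of a graded associative (resp. Lie)
    algebra. *)
Definition quadratic (d : CV) : Prop :=
  forall e v, size v != 2 -> d e v = 0.

Definition delta (d x : CV) : precochain V := mu kd d x.

End InfinityAlgebra.

(** The quotient of a module by a submodule. *)
Section QuotientModule.
Variables (k : fieldType) (M : lmodType k).
Variables (S : zmodClosed M) (SZ : scaler_closed S).
Local Open Scope quotient_scope.

Definition qmod of scaler_closed S := Quotient.quot S.
Local Notation Q := (qmod SZ).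
HB.instance Definition _ := GRing.Zmodule.on Q.
HB.instance Definition _ : EqQuotient M (Quotient.equiv S) Q :=
  EqQuotient.on Q.

Definition qpi (x : M) : Q := \pi_Q x.
Definition qscale (a : k) (h : Q) : Q := qpi (a *: repr h).

Lemma qpi_eq (x y : M) : (qpi x = qpi y) <-> (x - y \in S).
Proof. by rewrite Quotient.idealrBE; split=> [/eqP|/eqP]. Qed.

Lemma qscale_pi a x : qscale a (qpi x) = qpi (a *: x).
Proof.
apply/qpi_eq; rewrite -scalerBr; apply: SZ.
by apply/qpi_eq; rewrite /qpi reprK.
Qed.

Lemma qpiD x y : qpi (x + y) = qpi x + qpi y.
Proof. exact: (raddfD (\pi_(Quotient.quot S))). Qed.

Lemma qpi_repr (h : Q) : qpi (repr h) = h.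
Proof. exact: reprK. Qed.

Fact qscaleA a b h : qscale a (qscale b h) = qscale (a * b) h.
Proof. by rewrite -(qpi_repr h) !qscale_pi scalerA. Qed.
Fact qscale1 : left_id 1 qscale.
Proof. by move=> h; rewrite -(qpi_repr h) qscale_pi scale1r. Qed.
Fact qscaleDr : right_distributive qscale +%R.
Proof.
by move=> a g h; rewrite -(qpi_repr g) -(qpi_repr h) -qpiD !qscale_pi scalerDr qpiD.
Qed.
Fact qscaleDl h : {morph qscale^~ h : a b / a + b}.
Proof. by move=> a b; rewrite -(qpi_repr h) !qscale_pi scalerDl qpiD. Qed.

HB.instance Definition _ :=
  GRing.Zmodule_isLmodule.Build k Q qscaleA qscale1 qscaleDr qscaleDl.

End QuotientModule.

Section Cohomology.
Variables (kd : infty_kind) (k : fieldType) (V : bool -> lmodType k).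
Variable d : C kd V.
Local Notation CV := (C kd V).
Local Notation W := (tot V).

Lemma circ_linr n l q (f g h : seq W -> W) (a : k) b v :
    (forall s t c u w,
      f (s ++ (c *: u + w) :: t) = c *: f (s ++ u :: t) + f (s ++ w :: t)) ->
  circ kd n l q f (a *: g + h) b v =
  a *: circ kd n l q f g b v + circ kd n l q f h b v.
Proof.
move=> fl; rewrite /circ; case: kd; rewrite /circA /circL.
  rewrite scaler_sumr -big_split; apply: eq_bigr => j _ /=.
  by rewrite [(a *: g + h) _]/(a *: g _ + h _) fl scalerDr !scalerA mulrC.
rewrite scaler_sumr -big_split; apply: eq_bigr => s _ /=.
rewrite [(a *: g + h) _]/(a *: g _ + h _) (fl [::]).
by rewrite scalerDr !scalerA (mulrC a).
Qed.

Lemma circ_linl n l q (f g h : seq W -> W) (a : k) b v :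
  circ kd n l q (a *: g + h) f b v =
  a *: circ kd n l q g f b v + circ kd n l q h f b v.
Proof.
have E w : (a *: g + h) w = a *: g w + h w by [].
rewrite /circ; case: kd; rewrite /circA /circL.
  rewrite scaler_sumr -big_split; apply: eq_bigr => j _ /=.
  by rewrite E scalerDr !scalerA mulrC.
rewrite scaler_sumr -big_split; apply: eq_bigr => s _ /=.
by rewrite E scalerDr !scalerA (mulrC a).
Qed.

Lemma delta_lin (a : k) (x y : CV) :
  delta d (a *: x + y) = a *: delta d x + delta d y.
Proof.
have [_ dl _ _] : cochain kd (cval d) by apply/asboolP; exact: (valP d).
apply/funext => e; apply/funext => v.
have E (f g : precochain V) : (a *: f + g) e v = a *: f e v + g e v by [].
rewrite E {E} /delta /mu.
rewrite scaler_sumr -big_split; apply: eq_bigr => n _ /=.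
rewrite scaler_sumr -big_split; apply: eq_bigr => p _ /=.
rewrite !scalerA (mulrC a) -!scalerA -scalerDr; congr (_ *: _).
rewrite /br_comp scaler_sumr -big_split; apply: eq_bigr => b _ /=.
rewrite /br_hom.
have -> : cval (a *: x + y) (p (+) e) =
    a *: cval x (p (+) e) + cval y (p (+) e) by [].
rewrite circ_linr ?circ_linl; last by move=> *; exact: dl.
rewrite !scalerDr opprD !scalerN !scalerA (mulrC a).
by rewrite addrACA.
Qed.

Definition cocycle_pred : {pred CV} := fun x => `[< delta d x = 0 >].

Lemma cocycle_submod : submod_closed cocycle_pred.
Proof.
split; first by apply/asboolP; have := delta_lin (-1) 0 0; rewrite scaler0 addr0 scaleN1r addNr.
move=> a x y /asboolP hx /asboolP hy; apply/asboolP.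
by rewrite delta_lin hx hy scaler0 addr0.
Qed.

HB.instance Definition _ :=
  GRing.isSubmodClosed.Build k CV cocycle_pred cocycle_submod.

Definition Z := {x : CV | cocycle_pred x}.
HB.instance Definition _ := SubChoice.on Z.
HB.instance Definition _ := [SubChoice_isSubLmodule of Z by <:].

(** Coboundaries are automatically cocycles, because {d, d} = 0 and the
    characteristic is not 2; taking them inside Z makes the quotient H
    meaningful for any d. *)
Definition coboundary_pred : {pred Z} :=
  fun z => `[< exists y : CV, delta d y = cval (val z) >].

Lemma coboundary_submod : submod_closed coboundary_pred.
Proof.
split.
  apply/asboolP; exists 0.
  by have := delta_lin (-1) 0 0; rewrite scaler0 addr0 scaleN1r addNr.
move=> a x y /asboolP[u hu] /asboolP[v hv]; apply/asboolP; exists (a *: u + v).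
by rewrite delta_lin hu hv.
Qed.

HB.instance Definition _ :=
  GRing.isSubmodClosed.Build k Z coboundary_pred coboundary_submod.

Lemma coboundary_scaler : scaler_closed coboundary_pred.
Proof. exact: rpredZ. Qed.

Definition H : lmodType k := qmod coboundary_scaler.

Definition pi (z : Z) : H := qpi coboundary_scaler z.

(** x is a cocycle and belongs to the class h. *)
Definition in_class (x : CV) (h : H) : Prop :=
  exists2 z : Z, val z = x & pi z = h.

Definition class_bidegree (h : H) (e : bool) (m : int) : Prop :=
  exists2 x : CV, has_bidegree x e m & in_class x h.

End Cohomology.

Section Deformations.
Variables (kd : infty_kind) (k : fieldType) (V : bool -> lmodType k).
Local Notation CV := (C kd V).
Local Notation pre := (precochain V).

(** The pair (x, y) stands for x + theta y, so that
    {x + theta y, x' + theta y'}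
      = {x, x'} + theta ({y, x'} + (-1)^x {x, y'}). *)
Definition mu_theta (u w : pre * pre) : pre * pre :=
  (mu kd u.1 w.1, mu kd u.2 w.1 + mu kd (sign_op u.1) w.2).

(** The bracket of the formal series sum_i t^i D_i and sum_i t^i D'_i. *)
Definition mu_series (D D' : nat -> pre * pre) : nat -> pre * pre :=
  fun p => \sum_(0 <= i < p.+1) mu_theta (D i) (D' (p - i)%N).

Record formal_deformation (d : CV) (gamma beta : nat -> CV)
    (phi psi : nat -> nat -> CV) : Prop := FormalDeformation {
  deformation_gamma0 : gamma 0%N = d;
  deformation_beta0 : beta 0%N = 0;
  deformation_gamma : forall i, is_sum (gamma i) (phi i);
  deformation_beta : forall i, is_sum (beta i) (psi i);
  deformation_phi : forall i m, (0 < m)%N ->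
    has_bidegree (phi i m) (odd m) (m%:Z - 1);
  deformation_psi : forall i m, (0 < m)%N ->
    has_bidegree (psi i m) (odd m.-1) (m%:Z - 1);
  deformation_eq :
    let dt i : pre * pre := (cval (gamma i), cval (beta i)) in
    forall p, mu_series dt dt p = 0 }.

End Deformations.

(** Free modules [{malg k[T]}] on a choiceType T: linear extension of a map
    given on the basis, and the tensor product of two such modules, which is
    the free module on the product of the bases. *)
Section FreeModules.
Variables (k : fieldType) (T : choiceType).

Definition lin_ext (M : lmodType k) (g : T -> M) (x : {malg k[T]}) : M :=
  \sum_(b <- msupp x) x@_b *: g b.

Definition tensor (x y : {malg k[T]}) : {malg k[(T * T)%type]} :=
  \sum_(b <- msupp x) \sum_(c <- msupp y) (x@_b * y@_c) *: << (b, c) >>.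

End FreeModules.

Section Coalgebra.
Variable k : fieldType.

(** [(false, i, j)] indexes e^(i,j) and [(true, i, j)] indexes f^(i,j). *)
Definition is_index (b : bool * nat * int) : bool :=
  let: (_, i, j) := b in (0 < i)%N && (2 <= i%:Z + j).

Definition gen_index := {b : bool * nat * int | is_index b}.

Definition index_degree (b : gen_index) : bool :=
  let: (isf, _, j) := val b in isf (+) odd `|j|%N.
Definition index_weight (b : gen_index) : int :=
  let: (_, _, j) := val b in j - 2.
Definition index_parity (b : gen_index) : bool :=
  index_degree b (+) odd `|index_weight b|%N.

Definition F : lmodType k := {malg k[gen_index]}.
Definition FF : lmodType k := {malg k[(gen_index * gen_index)%type]}.

(** The basis vectors, extended by 0 outside of the index range. *)
Definition gen (isf : bool) (i : nat) (j : int) : F :=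
  if insub (isf, i, j) is Some b then << b >> : {malg k[gen_index]} else 0.
Definition Fe := gen false.
Definition Ff := gen true.

Definition F_bidegree (x : F) (e : bool) (m : int) : Prop :=
  forall b, b \in msupp (x : {malg k[gen_index]}) ->
    index_degree b = e /\ index_weight b = m.

(** For 1 <= i <= p - 1 the integers j with i + j >= 2 and
    (p - i) + (q + 2 - j) >= 2 are the 2 - i + s with 0 <= s < p + q - 1. *)
Definition Delta_sum (p : nat) (q : int) (t : nat -> int -> FF) : FF :=
  - (2%:R^-1 : k) *:
  \sum_(1 <= i < p) \sum_(0 <= s < `|(p%:Z + q - 1)%R|%N) t i (2 - i%:Z + s%:Z).

Definition Delta_index (b : gen_index) : FF :=
  let: (isf, p, q) := val b in
  if isf then
    Delta_sum p q (fun i j =>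
      tensor (Ff i j) (Fe (p - i) (q + 2 - j))
      + tensor (Fe i j) (Ff (p - i) (q + 2 - j)))
  else
    Delta_sum p q (fun i j => tensor (Fe i j) (Fe (p - i) (q + 2 - j))).

Definition Delta : F -> FF := lin_ext Delta_index.

(** F_0 is the span of the e^(1,j) and f^(1,j). *)
Definition F0_pred : {pred F} := fun x =>
  all (fun b : gen_index => (val b).1.2 == 1%N) (msupp (x : {malg k[gen_index]})).

Lemma F0P (x : F) : reflect
  (forall b : gen_index, (val b).1.2 != 1%N -> (x : {malg k[gen_index]})@_b = 0)
  (x \in F0_pred).
Proof.
apply: (iffP allP) => h b.
  by move=> hb; apply/eqP; apply: contraNT hb; rewrite mcoeff_neq0; apply: h.
rewrite -mcoeff_neq0 => hb; apply: contraNT hb => hb; apply/eqP; exact: h.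
Qed.

Lemma F0_submod : submod_closed F0_pred.
Proof.
split; first by apply/F0P => b _; rewrite mcoeff0.
move=> a x y /F0P hx /F0P hy; apply/F0P => b hb.
by rewrite mcoeffD mcoeffZ hx // hy // mulr0 addr0.
Qed.

HB.instance Definition _ :=
  GRing.isSubmodClosed.Build k F F0_pred F0_submod.

Definition F0 := {x : F | F0_pred x}.
HB.instance Definition _ := SubChoice.on F0.
HB.instance Definition _ := [SubChoice_isSubLmodule of F0 by <:].

Lemma gen_F0 isf j : gen isf 1 j \in F0_pred.
Proof.
rewrite /gen; case: insubP => [b _ hb|_]; last first.
  by apply/F0P => b _; rewrite mcoeff0.
apply/F0P => c hc; rewrite mcoeffU; case: eqP => // e.
by move: hc; rewrite -e hb.
Qed.

Definition F0e (j : int) : F0 := Sub (Fe 1 j) (gen_F0 false j).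
Definition F0f (j : int) : F0 := Sub (Ff 1 j) (gen_F0 true j).

End Coalgebra.

Section Massey.
Variables (kd : infty_kind) (k : fieldType) (V : bool -> lmodType k).
Local Notation CV := (C kd V).

(** The composition of mu with alpha (x) alpha, as a map from F (x) F. *)
Definition mu_alpha (alpha : F k -> CV) : FF k -> precochain V :=
  lin_ext (fun bc : (gen_index * gen_index)%type =>
    (-1) ^+ index_parity bc.1 *:
    mu kd (alpha << bc.1 >>) (alpha << bc.2 >>)).

Definition massey_trivial (d : CV) (a : F0 k -> H d) : Prop :=
  exists alpha : {linear F k -> CV},
    [/\ (forall x e m, F_bidegree x e m -> has_bidegree (alpha x) e (m + 1)),
        (forall x, delta d (alpha x) = mu_alpha alpha (Delta x)) &
        (forall x : F0 k, in_class (alpha (val x)) (a x))].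

End Massey.

(* Main.v *)
From HB Require Import structures.
Require Import Defs.
From mathcomp Require Import all_boot all_algebra.
From mathcomp Require Import boolp functions finmap zify.
From mathcomp.multinomials Require Import monalg.

Set Implicit Arguments.
Unset Strict Implicit.
Unset Printing Implicit Defensive.

Import GRing.Theory.
Local Open Scope ring_scope.

(** Write [alpha e^(i,j) = phi_(i,j)] and [alpha f^(i,j) = psi_(i,j)].  The
    bracket of two odd elements is symmetric and that of an odd and an even
    element is antisymmetric, so for [p > 0] the coefficients of [t^p] and
    [t^p theta] in [{d_t, d_t}] are [2 delta gamma_p + sum {gamma_i, gamma_(p-i)}]
    and [- 2 delta beta_p + sum ({beta_i, gamma_(p-i)} - {gamma_i, beta_(p-i)})],
    the sums being over [0 < i < p].  Dividing by 2, their vanishing in arity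
    [q + 1] is exactly the Massey equation for [e^(p,q)], resp. [f^(p,q)].  The
    generators with [j <= 0], which do not occur in [d_t], must be mapped to 0
    since there are no cochains of arity [j <= 0]; their equations contain the
    arity 1 part of [{d_t, d_t}], which does not involve [delta]. *)

(** * The bracket: linearity, dependence on arity, graded symmetry *)

Section Bracket.
Variables (kd : infty_kind) (k : fieldType) (V : bool -> lmodType k).
Local Notation W := (tot V).
Local Notation CV := (C kd V).
Implicit Types (f g h : seq W -> W) (v w : seq W) (x y z : CV).

Definition multilinear f := forall s t (a : k) (u v : W),
  f (s ++ (a *: u + v) :: t) = a *: f (s ++ u :: t) + f (s ++ v :: t).

Lemma cochainP x : cochain kd (cval x).
Proof. by apply/asboolP; exact: (valP x). Qed.

Lemma cochain_multilinear x e : multilinear (x e).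
Proof. exact: (cochain_lin (cochainP x)). Qed.

Lemma cochain_arity0 x e v : size v = 0%N -> x e v = 0.
Proof. by move/size0nil->; exact: (cochain_nil (cochainP x)). Qed.

Lemma cochain_eq x y : (forall e v, x e v = y e v) -> x = y.
Proof.
move=> xy; apply: val_inj; apply/funext => e; apply/funext => v; exact: xy.
Qed.

(** The inner map only receives lists of length [l] and the outer one lists of length [n], so
    components of other arities do not matter. *)
Lemma circ_eq n l q f f' g g' b v : (size v).+1 = (n + l)%N ->
    (0 < n)%N -> (0 < l)%N ->
    (forall w, size w = n -> f w = f' w) ->
    (forall w, size w = l -> g w = g' w) ->
  circ kd n l q f g b v = circ kd n l q f' g' b v.
Proof.
move=> vnl n0 l0 ff' gg'; have vN : size v = (n + l).-1 by rewrite -vnl.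
rewrite /circ; case: kd.
  apply: eq_big_nat => j /andP[_ jn]; congr (_ *: _).
  have sg : size (take l (drop j v)) = l by rewrite size_takel // size_drop vN; lia.
  rewrite (gg' _ sg) ff' // size_cat /= size_drop size_takel vN; lia.
apply: eq_bigr => s _; congr (_ *: _).
have sp : size (permute s v) = size v by rewrite size_map size_enum_ord.
have sg : size (take l (permute s v)) = l by rewrite size_takel // sp vN; lia.
by rewrite (gg' _ sg) ff' //= size_drop sp vN; lia.
Qed.

Lemma circ0l n l q g b v : multilinear g -> circ kd n l q 0 g b v = 0.
Proof.
(* Linearity at [0 = -1 *: 0 + 0] turns the value X into -X + X. *)
move=> gl; have := circ_linl kd n l q g 0 0 (-1) b v.
by rewrite scaler0 addr0 scaleN1r addNr.
Qed.

Lemma circ0r n l q f b v : multilinear f -> circ kd n l q f 0 b v = 0.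
Proof.
move=> fl; have := circ_linr kd n l q 0 0 (-1) b v fl.
by rewrite scaler0 addr0 scaleN1r addNr.
Qed.

Lemma size_hparts (b : seq bool) v : size b = size v -> size (hparts b v) = size v.
Proof. by move=> bv; rewrite size_map size_zip bv minnn. Qed.

Lemma br_comp_eq n l p q f f' g g' v : (size v).+1 = (n + l)%N ->
    (0 < n)%N -> (0 < l)%N ->
    (forall w, size w = n -> f w = f' w) ->
    (forall w, size w = l -> g w = g' w) ->
  br_comp kd n l p q f g v = br_comp kd n l p q f' g' v.
Proof.
move=> vnl n0 l0 ff' gg'; apply: eq_bigr => b _; rewrite /br_hom.
have sv : size (hparts b v) = size v by rewrite size_hparts ?size_tuple.
by congr (_ - _ *: _); apply: circ_eq => //; rewrite sv // addnC.
Qed.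

(** [f] may be replaced by the zero map; in the second sum this zero becomes an argument of [g],
    which is multilinear. *)
Lemma br_comp0l n l p q f g v : (size v).+1 = (n + l)%N ->
    (0 < n)%N -> (0 < l)%N -> multilinear g ->
  (forall w, size w = n -> f w = 0) -> br_comp kd n l p q f g v = 0.
Proof.
move=> vnl n0 l0 gl f0; rewrite (@br_comp_eq _ _ _ _ _ 0 _ g) //.
by apply: big1 => b _; rewrite /br_hom circ0l // circ0r // scaler0 subr0.
Qed.

(** The two sums of [br_hom] trade places, and the sign between them squares to 1. *)
Lemma br_comp_skew n l p q f g v :
  br_comp kd l n q p g f v =
  - ((-1) ^+ (p * q + n.-1 * l.-1)%N *: br_comp kd n l p q f g v).
Proof.
rewrite /br_comp scaler_sumr -sumrN; apply: eq_bigr => b _.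
rewrite /br_hom scalerBr opprB scalerA -exprD addnn -mul2n exprM sqrrN !expr1n.
by rewrite scale1r (mulnC p) (mulnC n.-1).
Qed.

Lemma br_comp0r n l p q f g v : (size v).+1 = (n + l)%N ->
    (0 < n)%N -> (0 < l)%N -> multilinear f ->
  (forall w, size w = l -> g w = 0) -> br_comp kd n l p q f g v = 0.
Proof.
move=> vnl n0 l0 fl g0.
by rewrite br_comp_skew br_comp0l ?scaler0 ?oppr0 // addnC.
Qed.

Lemma mu_linl (a : k) x y z :
  mu kd (a *: x + y : CV) z = a *: mu kd x z + mu kd y z.
Proof.
apply/funext => e; apply/funext => v.
have E (f g : precochain V) : (a *: f + g) e v = a *: f e v + g e v by [].
rewrite E {E} /mu scaler_sumr -big_split; apply: eq_bigr => n _ /=.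
rewrite scaler_sumr -big_split; apply: eq_bigr => p _ /=.
rewrite scalerA (mulrC a) -scalerA -scalerDr; congr (_ *: _).
rewrite /br_comp scaler_sumr -big_split; apply: eq_bigr => b _ /=.
rewrite /br_hom.
have -> : cval (a *: x + y) p = a *: cval x p + cval y p by [].
rewrite circ_linr ?circ_linl; last by move=> *; exact: cochain_multilinear.
rewrite !scalerDr opprD scalerN !scalerA (mulrC a).
by rewrite addrACA.
Qed.

Lemma mu0l z : mu kd (0 : CV) z = 0.
Proof. by have := mu_linl (-1) 0 0 z; rewrite scaler0 addr0 scaleN1r addNr. Qed.

Lemma mu0r z : mu kd z (0 : CV) = 0.
Proof.
by have := delta_lin z (-1) 0 0; rewrite scaler0 addr0 scaleN1r addNr.
Qed.

Lemma muNl x z : mu kd (- x : CV) z = - mu kd x z.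
Proof. by have := mu_linl (-1) x 0 z; rewrite addr0 mu0l addr0 !scaleN1r. Qed.

(** Homogeneity for the grading by total parity, in which [mu] is graded antisymmetric. *)
Definition has_parity x (a : bool) :=
  forall e v, parity e (size v) != a -> x e v = 0.

(** Summands are paired by exchanging the arities [n] and [l] and the degrees [p] and [q]; the sign
    is then a congruence modulo 2. *)
Lemma mu_skew x y (a c : bool) : has_parity x a -> has_parity y c ->
  mu kd y x = - ((-1) ^+ (a * c)%N *: mu kd x y).
Proof.
move=> xa yc; apply/funext => e; apply/funext => v.
have -> : (- ((-1) ^+ (a * c)%N *: mu kd x y)) e v =
          - ((-1) ^+ (a * c)%N *: mu kd x y e v) by [].
rewrite /mu big_nat_rev scaler_sumr -sumrN; apply: eq_big_nat => n /andP[n0 nv].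
rewrite (reindex_inj (can_inj (addbK e))) scaler_sumr -sumrN.
apply: eq_bigr => p _ /=; rewrite addbK.
have -> : (1 + (size v).+1 - n.+1 = (size v).+1 - n)%N by lia.
have -> : ((size v).+1 - ((size v).+1 - n) = n)%N by lia.
set l := ((size v).+1 - n)%N; set q := p (+) e.
have l0 : (0 < l)%N by lia.
have vnl : (size v).+1 = (n + l)%N by lia.
(* A summand in which [x] or [y] would contribute the wrong parity vanishes on both sides, so [a]
   and [c] can be read off from the bidegrees. *)
have [pa|pa] := eqVneq (parity p n) a; last first.
  rewrite [br_comp _ n _ _ _ _ _ _]br_comp0l //; last first.
  - by move=> w wn; apply: xa; rewrite wn.
  - exact: cochain_multilinear.
  rewrite br_comp0r ?scaler0 ?oppr0 //; first by lia.
  - exact: cochain_multilinear.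
  - by move=> w wn; apply: xa; rewrite wn.
have [qc|qc] := eqVneq (parity q l) c; last first.
  rewrite [br_comp _ n _ _ _ _ _ _]br_comp0r //; last first.
  - by move=> w wn; apply: yc; rewrite wn.
  - exact: cochain_multilinear.
  rewrite br_comp0l ?scaler0 ?oppr0 //; first by lia.
  - exact: cochain_multilinear.
  - by move=> w wn; apply: yc; rewrite wn.
rewrite br_comp_skew scalerN !scalerA -!exprD; congr (- (_ *: _)).
(* Modulo 2, the product of the parities [p + n.-1] and [q + l.-1] is the exponent of the unmodified
   bracket plus the exponents [n.-1 * q] and [l.-1 * p] of the two modifying signs. *)
rewrite -[LHS]signr_odd -[RHS]signr_odd; congr (_ ^+ nat_of_bool _).
rewrite -pa -qc /parity !(oddD, oddM, oddb).
by case: p @q {pa qc} => q; case: q; case: (odd n.-1); case: (odd l.-1).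
Qed.

(** On inputs of a given length only finitely many arity pairs occur, so brackets of infinite sums
    reduce to brackets of components. *)
Lemma mu_sum x y (xs ys : nat -> CV) : is_sum x xs -> is_sum y ys ->
    (forall n e v, size v != n -> xs n e v = 0) ->
    (forall n e v, size v != n -> ys n e v = 0) ->
  forall e v, mu kd x y e v =
    \sum_(1 <= n < (size v).+1) mu kd (xs n) (ys ((size v).+1 - n)%N) e v.
Proof.
move=> xxs yys xs0 ys0 e v; apply: eq_big_nat => n /andP[n0 nv] /=.
set l := ((size v).+1 - n)%N.
have l0 : (0 < l)%N by lia.
(* The bracket of [xs n] and [ys l] is again a sum over arities; all its terms except the one at [n]
   vanish. *)
rewrite /mu (@bigD1_seq _ _ _ _ _ n) ?iota_uniq ?mem_index_iota ?n0 //=.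
rewrite -[LHS]addr0; congr (_ + _).
  apply: eq_bigr => p _; congr (_ *: _); apply: br_comp_eq => //; first by lia.
  - by move=> w <-; exact: xxs.
  - by move=> w <-; exact: yys.
symmetry; rewrite big_nat_cond; apply: big1 => m /andP[/andP[m0 mv] mn].
have vm : (size v).+1 = (m + ((size v).+1 - m))%N by rewrite subnKC // ltnW.
apply: big1 => p _; rewrite (br_comp0l _ _ vm) ?scaler0 ?subn_gt0 //.
  exact: cochain_multilinear.
by move=> w wm; apply: xs0; rewrite wm.
Qed.

Lemma mu_arity x y m n e v : 
    (forall e v, size v != m -> x e v = 0) ->
    (forall e v, size v != n -> y e v = 0) ->
  (size v).+1 != (m + n)%N -> mu kd x y e v = 0.
Proof.
move=> xm yn vmn; rewrite /mu big_nat_cond; apply: big1 => i /andP[/andP[i0 iv] _].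
have vi : (size v).+1 = (i + ((size v).+1 - i))%N by rewrite subnKC // ltnW.
apply: big1 => p _.
have [im|im] := eqVneq i m.
  rewrite (br_comp0r _ _ vi) ?scaler0 ?subn_gt0 //.
    exact: cochain_multilinear.
  by move=> w wi; apply: yn; rewrite wi; apply/eqP; lia.
rewrite (br_comp0l _ _ vi) ?scaler0 ?subn_gt0 //.
  exact: cochain_multilinear.
by move=> w wi; apply: xm; rewrite wi.
Qed.

End Bracket.

(** * Linear extension and basis tensors in free modules *)

Section FreeModule.
Variables (k : fieldType) (T : choiceType) (M : lmodType k) (g : T -> M).

(** Provides a common index set for elements with different supports, from which additivity of
    [lin_ext] follows. *)
Lemma lin_ext_incl (D : {fset T}) (x : {malg k[T]}) :
  (msupp x `<=` D)%fset -> lin_ext g x = \sum_(b <- D) x@_b *: g b.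
Proof.
move=> xD; apply: big_fset_incl => // b _ /mcoeff_outdom->.
by rewrite scale0r.
Qed.

Lemma lin_ext_is_linear : linear (lin_ext g).
Proof.
move=> a x y; pose D := (msupp x `|` msupp y)%fset.
have axD : (msupp (a *: x) `<=` D)%fset.
  exact: fsubset_trans (msuppZ_le _ _) (fsubsetUl _ _).
have yD : (msupp y `<=` D)%fset by exact: fsubsetUr.
rewrite (@lin_ext_incl D) ?(@lin_ext_incl D x) ?(@lin_ext_incl D y) //.
- rewrite scaler_sumr -big_split; apply: eq_bigr => b _ /=.
  by rewrite mcoeffD mcoeffZ scalerDl scalerA.
- exact: fsubsetUl.
- by apply: fsubset_trans (msuppD_le _ _) _; rewrite fsubUset axD.
Qed.

HB.instance Definition _ :=
  GRing.isLinear.Build k {malg k[T]} M *:%R (lin_ext g) lin_ext_is_linear.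

Lemma lin_extU b : lin_ext g << b >> = g b.
Proof. by rewrite /lin_ext msuppU oner_eq0 big_seq_fset1 mcoeffUU scale1r. Qed.

Lemma malg_basisE (x : {malg k[T]}) : x = \sum_(b <- msupp x) x@_b *: << b >>.
Proof.
rewrite {1}[x]monalgE; apply: eq_bigr => b _; apply/malgP => c.
by rewrite mcoeffZ !mcoeffU mulr_natr.
Qed.

Lemma malg_linear_eq (f h : {linear {malg k[T]} -> M}) :
  (forall b, f << b >> = h << b >>) -> f =1 h.
Proof.
move=> fh x; rewrite [x]malg_basisE !linear_sum; apply: eq_bigr => b _.
by rewrite /= !linearZ /= fh.
Qed.

Lemma tensorUU (b c : T) :
  tensor << b >> << c >> = << (b, c) >> :> {malg k[(T * T)%type]}.
Proof.
by rewrite /tensor msuppU oner_eq0 big_seq_fset1 msuppU oner_eq0 big_seq_fset1 !mcoeffUU mulr1 scale1r.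
Qed.

Lemma tensor0l (y : {malg k[T]}) : tensor 0 y = 0.
Proof. by rewrite /tensor msupp0 big_seq_fset0. Qed.

Lemma tensor0r (x : {malg k[T]}) : tensor x 0 = 0.
Proof. by rewrite /tensor msupp0 big1 // => b _; rewrite big_seq_fset0. Qed.

End FreeModule.

(** * Parity and comultiplication of the generators *)

Section Generators.
Variable k : fieldType.

Lemma gen_bidegree s i j : F_bidegree (gen k s i j) (s (+) odd `|j|%N) (j - 2).
Proof.
move=> b; rewrite /gen; case: insubP => [c _ vc|_]; last by rewrite msupp0 inE.
rewrite msuppU oner_eq0 inE => /eqP->.
by rewrite /index_degree /index_weight vc.
Qed.

Lemma gen_val (b : gen_index) :
  gen k (val b).1.1 (val b).1.2 (val b).2 = << b >>.
Proof.
by rewrite /gen -!surjective_pairing valK.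
Qed.

(** In degree plus weight the two copies of [j] cancel: every e is even and every f odd, whence the
    signs in [mu_alpha]. *)
Lemma index_parityE (b : gen_index) : index_parity b = (val b).1.1.
Proof.
case: b => [[[s i] j] h]; rewrite /index_parity /index_degree /index_weight /=.
by rewrite -addbA; case: (s) => /=; lia.
Qed.

Definition Delta_formula s p (q : int) : FF k :=
  if s then Delta_sum p q (fun i j =>
      tensor (Ff k i j) (Fe k (p - i) (q + 2 - j))
      + tensor (Fe k i j) (Ff k (p - i) (q + 2 - j)))
  else Delta_sum p q (fun i j => tensor (Fe k i j) (Fe k (p - i) (q + 2 - j))).

Lemma Delta_gen_index s p q : is_index (s, p, q) ->
  Delta (gen k s p q) = Delta_formula s p q.
Proof.
rewrite /gen /Delta; case: insubP => [c _ vc _|/negPf->] //.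
by rewrite lin_extU /Delta_index vc.
Qed.

(** Reaches every [q] for which [q + 1] is a length of inputs, including generators outside the
    index range, which are zero. *)
Lemma Delta_gen s p (q : int) : (0 < p)%N -> -1 <= q ->
  Delta (gen k s p q) = Delta_formula s p q.
Proof.
move=> p0 q1; have [/Delta_gen_index//|/negPf spq] := boolP (is_index (s, p, q)).
rewrite /gen insubF // /Delta raddf0; move: spq; rewrite /is_index p0 /= => pq.
have D0 t : Delta_sum p q t = 0 :> FF k.
  rewrite /Delta_sum big_nat_cond big1 ?scaler0 // => i /andP[/andP[i0 ip] _].
  (* Here [p >= 2], so [q >= -1] and [p + q < 2] leave only [p + q = 1], where the inner range is
     empty. *)
  by rewrite big_geq //; lia.
by rewrite /Delta_formula; case: s; rewrite D0.
Qed.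

End Generators.

HB.instance Definition _ (k : fieldType) :=
  GRing.isLinear.Build k (F k) (FF k) *:%R (@Delta k) (lin_ext_is_linear _).

HB.instance Definition _ (kd : infty_kind) (k : fieldType)
    (V : bool -> lmodType k) (alpha : F k -> C kd V) :=
  GRing.isLinear.Build k (FF k) (precochain V) *:%R (mu_alpha alpha)
    (lin_ext_is_linear _).

(** * The Massey equation evaluated arity by arity *)

Section Evaluation.
Variables (kd : infty_kind) (k : fieldType) (V : bool -> lmodType k).
Local Notation CV := (C kd V).
Local Notation W := (tot V).
Variables (d : CV) (d_quadratic : quadratic d).
(** [G false i] and [G true i] stand for the coefficients gamma_i and beta_i. *)
Variables (alpha : {linear F k -> CV}) (G : bool -> nat -> CV).
Local Notation al s i j := (cval (alpha (gen k s i j))).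
Hypothesis alpha_bideg :
  forall x e m, F_bidegree x e m -> has_bidegree (alpha x) e (m + 1).
Hypothesis G_alpha : forall s i e (v : seq W), (0 < i)%N ->
  G s i e v = al s i (size v)%:Z e v.

(* The part of [{d_t, d_t}] at [t^p], resp. (up to sign) at [t^p theta] for
   [s = true], that does not involve [d]. *)
Definition quad_part s p : precochain V :=
  if s then \sum_(1 <= i < p) (mu kd (G false i) (G true (p - i))
                               - mu kd (G true i) (G false (p - i)))
  else \sum_(1 <= i < p) mu kd (G false i) (G false (p - i)).

Lemma alpha_arity s i j e (v : seq W) : (size v)%:Z != j ->
  al s i j e v = 0.
Proof.
move=> vj; have bg := alpha_bideg (@gen_bidegree k s i j); apply: bg.
by rewrite negb_and; apply/orP; right; lia.
Qed.

Lemma alpha_gen_le0 s i (j : int) : j <= 0 -> alpha (gen k s i j) = 0.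
Proof.
move=> j0; apply: cochain_eq => e v.
have [vj|vj] := eqVneq (size v)%:Z j; last exact: alpha_arity.
by apply: cochain_arity0; lia.
Qed.

(** In arity [j] the degree is [j] for gamma and [j - 1] for beta; adding [j - 1] makes gamma odd
    and beta even, whatever [j] is. *)
Lemma G_parity s i : (0 < i)%N -> has_parity (G s i) (~~ s).
Proof.
move=> i0 e v; rewrite G_alpha // /parity => eps.
have [v0|v0] := posnP (size v); first exact: cochain_arity0.
have bg := alpha_bideg (@gen_bidegree k s i (size v)%:Z); apply: bg.
rewrite negb_and; apply/orP; left; apply: contraNneq eps => ->.
by rewrite -addbA absz_nat -{1}(prednK v0) /= addNb addbb addbT.
Qed.

Lemma mu_G s s' i j e (v : seq W) : (0 < i)%N -> (0 < j)%N ->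
  mu kd (G s i) (G s' j) e v =
  \sum_(1 <= n < (size v).+1)
    mu kd (al s i n) (al s' j ((size v).+1 - n)%N) e v.
Proof.
move=> i0 j0.
apply: (mu_sum (xs := fun n : nat => alpha (gen k s i n))
               (ys := fun n : nat => alpha (gen k s' j n))).
- by move=> e' w; apply: G_alpha.
- by move=> e' w; apply: G_alpha.
- by move=> n e' w wn; apply: alpha_arity.
- by move=> n e' w wn; apply: alpha_arity.
Qed.

Lemma mu_alpha_arity s s' i i' (j j' : int) e (v : seq W) :
    (size v)%:Z + 1 != j + j' ->
  mu kd (al s i j) (al s' i' j') e v = 0.
Proof.
case: j => [n|n]; last by rewrite (@alpha_gen_le0 _ _ (Negz n)) // mu0l.
case: j' => [m|m]; last by rewrite (@alpha_gen_le0 _ _ (Negz m)) // mu0r.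
move=> vnm; apply: (@mu_arity _ _ _ _ _ n m); last by lia.
- by move=> e' w wn; apply: alpha_arity.
- by move=> e' w wn; apply: alpha_arity.
Qed.

Lemma mu_arity0 (x y : CV) e (v : seq W) : size v = 0%N -> mu kd x y e v = 0.
Proof. by move=> v0; rewrite /mu v0 big_geq. Qed.

(* The indices outside [1 <= j <= q + 1] contribute 0: one of the two
   arities is then not positive. *)
Lemma mu_alpha_sum s s' p i (q : int) e (v : seq W) : (0 < i < p)%N ->
    (size v)%:Z = q + 1 ->
  \sum_(0 <= t < `|(p%:Z + q - 1)%R|%N)
    mu kd (al s i (2 - i%:Z + t%:Z))
          (al s' (p - i)%N (q + 2 - (2 - i%:Z + t%:Z))) e v =
  mu kd (G s i) (G s' (p - i)%N) e v.
Proof.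
move=> /andP[i0 ip] vq.
have [v0|v0] := posnP (size v).
  by rewrite mu_arity0 // big1 // => t _; rewrite mu_arity0.
rewrite mu_G // ?subn_gt0 //.
have {vq} -> : q = (size v)%:Z - 1 by lia.
move: (size v) v0 => N N0.
(* Three blocks: [i.-1] indices with first arity at most 0, [N] indices running through the arities
   1 to [N], and [(p - i).-1] indices with second arity at most 0. *)
have -> : `|(p%:Z + (N%:Z - 1) - 1)%R|%N = (i.-1 + N + (p - i).-1)%N by lia.
rewrite (big_cat_nat (n := i.-1 + N)) ?leq_addr //=.
rewrite (big_cat_nat (n := i.-1)) ?leq_addr //=.
rewrite big_nat_cond big1 ?add0r => [|t /andP[/andP[_ ti] _]]; last first.
  by rewrite alpha_gen_le0 ?mu0l //; lia.
rewrite [X in _ + X]big_nat_cond [X in _ + X]big1 ?addr0 => [|t /andP[/andP[ti _] _]]; last first.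
  by rewrite (@alpha_gen_le0 s') ?mu0r //; lia.
rewrite -[X in \sum_(X <= _ < _) _]add0n big_addn addKn [RHS]big_add1 /=.
apply: eq_big_nat => t /andP[_ tN].
have -> : 2 - i%:Z + (t + i.-1)%:Z = t.+1 by lia.
by have -> : N%:Z - 1 + 2 - t.+1%:Z = (N.+1 - t.+1)%N by lia.
Qed.

(** The sign is that of passing alpha over the first generator, of parity [s]; outside the index
    range both sides are zero. *)
Lemma mu_alpha_tensor s s' i i' j j' e (v : seq W) :
  mu_alpha (kd := kd) (V := V) alpha
    (tensor (gen k s i j) (gen k s' i' j')) e v =
  (-1) ^+ s *: mu kd (al s i j) (al s' i' j') e v.
Proof.
suff -> : mu_alpha (kd := kd) (V := V) alpha
            (tensor (gen k s i j) (gen k s' i' j')) =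
          (-1) ^+ s *: mu kd (al s i j) (al s' i' j') by [].
rewrite /mu_alpha /gen; case: insubP => [b _ vb|_]; last first.
  by rewrite tensor0l !raddf0 mu0l scaler0.
case: insubP => [c _ vc|_]; last by rewrite tensor0r !raddf0 mu0r scaler0.
by rewrite tensorUU lin_extU index_parityE vb.
Qed.

Lemma precochainB (f g : precochain V) e v : (f - g) e v = f e v - g e v.
Proof. by []. Qed.

Lemma precochainD (f g : precochain V) e v : (f + g) e v = f e v + g e v.
Proof. by []. Qed.

Lemma precochainZ a (f : precochain V) e v : (a *: f) e v = a *: f e v.
Proof. by []. Qed.

Lemma linear_Delta_sum_eval (h : {linear FF k -> precochain V}) p q t e (v : seq W) :
  h (Delta_sum p q t) e v = - 2^-1 *:
    \sum_(1 <= i < p) \sum_(0 <= s < `|(p%:Z + q - 1)%R|%N)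
       h (t i (2 - i%:Z + s%:Z)) e v.
Proof.
rewrite /Delta_sum linearZ /= raddf_sum precochainZ.
congr (_ *: _); rewrite !fct_sumE; apply: eq_bigr => i _.
by rewrite raddf_sum !fct_sumE.
Qed.

Lemma mu_alpha_Delta s p (q : int) e (v : seq W) : (0 < p)%N ->
    (size v)%:Z = q + 1 ->
  mu_alpha (kd := kd) (V := V) alpha (Delta (gen k s p q)) e v =
  - 2^-1 *: quad_part s p e v.
Proof.
move=> p0 vq; rewrite Delta_gen //; last by lia.
rewrite /quad_part /Delta_formula; case: s.
  rewrite (linear_Delta_sum_eval (mu_alpha alpha)); congr (_ *: _); rewrite !fct_sumE.
  apply: eq_big_nat => i ip.
  rewrite [RHS]precochainB -!(mu_alpha_sum _ _ _ ip vq) -sumrB.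
  apply: eq_bigr => t _; rewrite (raddfD (mu_alpha alpha)) /= /Fe /Ff precochainD.
  (* The term with f on the left gets the sign -1 because f is odd; this is the relative sign in
     [quad_part]. *)
  rewrite addrC; congr (_ + _); rewrite mu_alpha_tensor.
    by rewrite expr0 scale1r.
  by rewrite expr1 scaleN1r.
rewrite (linear_Delta_sum_eval (mu_alpha alpha)); congr (_ *: _); rewrite !fct_sumE.
apply: eq_big_nat => i ip; rewrite -(mu_alpha_sum _ _ _ ip vq).
by apply: eq_bigr => t _; rewrite /= /Fe mu_alpha_tensor expr0 scale1r.
Qed.


Lemma is_sum_d : is_sum d (fun n => if n == 2 then d else 0).
Proof. by move=> e v; case: eqP => // /eqP v2; rewrite d_quadratic. Qed.

(** Bracketing with the purely quadratic [d] raises arity by one, so inputs of length [q + 1] only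
    see the component of arity [q]. *)
Lemma delta_alpha s p (q : int) e (v : seq W) : (0 < p)%N ->
  (size v)%:Z = q + 1 -> delta d (alpha (gen k s p q)) e v = delta d (G s p) e v.
Proof.
move=> p0 vq.
rewrite [RHS](mu_sum (xs := fun n : nat => if n == 2 then d else 0)
               (ys := fun n : nat => alpha (gen k s p n)) is_sum_d); first last.
- by move=> n e' w wn; apply: alpha_arity.
- by move=> n e' w; have [->|//] := eqVneq n 2; apply: d_quadratic.
- by move=> e' w; apply: G_alpha.
(* For inputs of length at most 1 no splitting has first arity 2, and [q <= 0] makes the left side
   zero. *)
have [v2|v2] := leqP 2 (size v); last first.
  rewrite (@alpha_gen_le0 _ _ q); last by lia.
  rewrite /delta mu0r big_nat_cond big1 // => n /andP[/andP[n0 nv] _].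
  by case: eqP => [n2|_]; [lia|rewrite mu0l].
rewrite (@bigD1_seq _ _ _ _ _ 2%N) ?iota_uniq ?mem_index_iota //=.
rewrite big1 ?addr0 => [|n /negPf->]; last by rewrite mu0l.
by have -> : ((size v).+1 - 2)%N%:Z = q by lia.
Qed.

Lemma delta_alpha_arity s p (q : int) e (v : seq W) :
  (size v)%:Z != q + 1 -> delta d (alpha (gen k s p q)) e v = 0.
Proof.
case: q => [n|n] vq; last first.
  by rewrite (@alpha_gen_le0 _ _ (Negz n)) // /delta mu0r.
apply: (@mu_arity _ _ _ _ _ 2 n); last by lia.
- exact: d_quadratic.
- by move=> e' w wn; apply: alpha_arity.
Qed.

(** The second indices in every tensor of the comultiplication add up to [q + 2], so each bracket
    lives in arity [q + 1]. *)
Lemma mu_alpha_Delta_arity s p (q : int) e (v : seq W) : (0 < p)%N ->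
    is_index (s, p, q) -> (size v)%:Z != q + 1 ->
  mu_alpha (kd := kd) (V := V) alpha (Delta (gen k s p q)) e v = 0.
Proof.
move=> p0 spq vq.
have mu0 s1 s2 i j : mu kd (al s1 i j) (al s2 (p - i)%N (q + 2 - j)) e v = 0.
  by apply: mu_alpha_arity; lia.
rewrite Delta_gen_index // /Delta_formula.
case: s {spq}; rewrite (linear_Delta_sum_eval (mu_alpha alpha)).
  rewrite big1 ?scaler0 // => i _; rewrite big1 // => t _.
  rewrite (raddfD (mu_alpha alpha)) /= /Fe /Ff precochainD -[RHS]addr0.
  by congr (_ + _); rewrite mu_alpha_tensor mu0 scaler0.
rewrite big1 ?scaler0 // => i _; rewrite big1 // => t _.
by rewrite /= /Fe mu_alpha_tensor mu0 scaler0.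
Qed.

(** For fixed [s] and [p], letting [q] vary runs through all arities [q + 1] of the equation at
    order [p]. *)
Lemma massey_equation :
  (forall x, delta d (alpha x) = mu_alpha alpha (Delta x)) <->
  (forall s p, (0 < p)%N -> delta d (G s p) = - 2^-1 *: quad_part s p).
Proof.
split=> [eqA s p p0|eqG x].
  apply/funext => e; apply/funext => v; rewrite precochainZ.
  have vq : (size v)%:Z = (size v)%:Z - 1 + 1 by lia.
  by rewrite -(mu_alpha_Delta _ _ p0 vq) -eqA delta_alpha.
have basis b : delta d (alpha << b >>) = mu_alpha alpha (Delta << b >>).
  rewrite -gen_val.
  case: b => [[[s p] q] /= spq]; have /andP[p0 _] := spq.
  apply/funext => e; apply/funext => v.
  have [vq|vq] := eqVneq (size v)%:Z (q + 1).
    by rewrite delta_alpha // mu_alpha_Delta // eqG.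
  by rewrite delta_alpha_arity // mu_alpha_Delta_arity.
(* With [delta d] packed as a linear map, the equation on generators extends to all of [F]. *)
pose deltaL := GRing.isLinear.Build k CV (precochain V) *:%R (delta d) (delta_lin d).
pose D : {linear CV -> precochain V} := HB.pack (delta d) deltaL.
exact: (malg_linear_eq (f := D \o alpha) (h := mu_alpha alpha \o @Delta k) basis x).
Qed.

End Evaluation.

(** * The deformation equation order by order; sums of components; classes *)

Section Deformation.
Variables (kd : infty_kind) (k : fieldType) (V : bool -> lmodType k).
Local Notation CV := (C kd V).
Local Notation W := (tot V).

Lemma sign_op_odd (x : CV) : has_parity x true -> sign_op x = cval (- x).
Proof.
move=> xo; apply/funext => e; apply/funext => v; rewrite /sign_op.
have -> : cval (- x) e v = - x e v by [].
have [->|] := eqVneq (parity e (size v)) true; first by rewrite expr1 scaleN1r.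
by move/xo->; rewrite scaler0 oppr0.
Qed.

Lemma infty_structure_odd (d : CV) : infty_structure d -> has_parity d true.
Proof. by case=> d0 _ e v; rewrite eqb_id; exact: d0. Qed.

(** This is where the characteristic enters: the doubled term comes from the two brackets with
    [d]. *)
Lemma eq_half (M : lmodType k) (x y : M) : 2%N \notin [pchar k] ->
  x *+ 2 + y = 0 <-> x = - 2^-1 *: y.
Proof.
rewrite inE /= => k2; split=> [/eqP|->].
  rewrite addr_eq0 => /eqP xy.
  by rewrite scaleNr -scalerN -xy -scaler_nat scalerA mulVf // scale1r.
by rewrite -scaler_nat scalerA mulrN divff // scaleN1r addNr.
Qed.

Lemma mu_series_eq0 (d : CV) (G : bool -> nat -> CV) :
    2%N \notin [pchar k] -> infty_structure d ->
    G false 0%N = d -> G true 0%N = 0 ->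
    (forall s i, (0 < i)%N -> has_parity (G s i) (~~ s)) ->
  let dt i : precochain V * precochain V :=
    (cval (G false i), cval (G true i)) in
  (forall p, mu_series kd dt dt p = 0) <->
  (forall s p, (0 < p)%N -> delta d (G s p) = - 2^-1 *: quad_part G s p).
Proof.
move=> k2 dinf G0 G1 Gpar dt.
have d_odd := infty_structure_odd dinf.
have Godd i : has_parity (G false i) true.
  by case: i => [|i]; [rewrite G0|exact: Gpar].
(* The summands [i = 0] and [i = p] are the brackets with [d]. Graded symmetry makes them equal: to
   [delta] of gamma_p in the first component, to minus [delta] of beta_p in the second. *)
have series p : (0 < p)%N -> mu_series kd dt dt p =
    (delta d (G false p) *+ 2 + quad_part G false p,
     - (delta d (G true p) *+ 2 + quad_part G true p)).
  move=> p0; rewrite [LHS]surjective_pairing /mu_series.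
  rewrite (raddf_sum fst) (raddf_sum snd) /=; congr pair.
    rewrite big_ltn // big_nat_recr //= subn0 subnn G0.
    rewrite (mu_skew d_odd (Gpar false _ p0)) expr1 scaleN1r opprK.
    by rewrite addrCA addrC mulr2n.
  rewrite big_ltn // big_nat_recr //= subn0 subnn G0 G1 !sign_op_odd //.
  rewrite mu0l mu0r muNl add0r addr0.
  rewrite (mu_skew d_odd (Gpar true _ p0)) expr0 scale1r.
  rewrite mulr2n !opprD -!addrA; congr (_ + _); rewrite addrC; congr (_ + _).
  rewrite -sumrN; apply: eq_big_nat => i _.
  by rewrite opprB sign_op_odd // muNl.
split=> [eq0 s p p0|eqG p].
  apply/eq_half => //; have := eq0 p; rewrite series //.
  by case: s => -[e0 /eqP]; rewrite ?oppr_eq0 => /eqP.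
(* Order zero is the equation [{d, d} = 0]; its theta part vanishes because beta_0 does. *)
have [->|p0] := posnP p.
  rewrite /mu_series big_nat1 subnn /dt /mu_theta /= G0 G1 sign_op_odd // mu0l mu0r addr0.
  by case: dinf => _ ->.
rewrite series // !(proj2 (eq_half _ _ k2) (eqG _ _ p0)).
by rewrite oppr0.
Qed.

(** Each defining condition of a cochain compares lists of one length, hence involves a single
    [xs n]. *)
Fact cochain_sum_subproof (xs : nat -> CV) :
  cochain_pred kd (fun e (v : seq W) => xs (size v) e v).
Proof.
apply/asboolP; split.
- by move=> e; apply: cochain_arity0.
- by move=> e s t a u v; rewrite !size_cat /= cochain_multilinear.
- by move=> e b v; apply: (cochain_deg (cochainP _)).
- move=> L e s t b c u v hu hv; rewrite !size_cat /=.
  exact: (cochain_alt (cochainP _)).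
Qed.

Definition cochain_sum (xs : nat -> CV) : CV := Sub _ (cochain_sum_subproof xs).

Lemma cochain_sumP (xs : nat -> CV) : is_sum (cochain_sum xs) xs.
Proof. by []. Qed.

Lemma has_bidegree0 e m : has_bidegree (0 : CV) e m.
Proof. by []. Qed.

Lemma has_bidegree_lin (a : k) (x y : CV) e m :
  has_bidegree x e m -> has_bidegree y e m -> has_bidegree (a *: x + y) e m.
Proof.
move=> xem yem e' v ev.
have -> : cval (a *: x + y) e' v = a *: cval x e' v + cval y e' v by [].
by rewrite xem // yem // scaler0 addr0.
Qed.

Lemma in_class0 (d : CV) : in_class (d := d) 0 0.
Proof.
exists 0 => //; apply: (addrI (Defs.pi (0 : Z d))).
by rewrite /Defs.pi -[LHS]qpiD !addr0.
Qed.

Lemma in_class_lin (d : CV) (a : k) (x y : CV) (h h' : H d) :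
  in_class x h -> in_class y h' -> in_class (a *: x + y) (a *: h + h').
Proof.
move=> [z <- <-] [z' <- <-]; exists (a *: z + z') => //.
by rewrite /Defs.pi qpiD -qscale_pi.
Qed.

End Deformation.

(** * Linear maps on [F] and [F0] controlled by their values on generators *)

Section MasseyMap.
Variables (kd : infty_kind) (k : fieldType) (V : bool -> lmodType k).
Local Notation CV := (C kd V).

Lemma lin_ext_bidegree (g : gen_index -> CV) :
    (forall b, has_bidegree (g b) (index_degree b) (index_weight b + 1)) ->
  forall (x : F k) e m, F_bidegree x e m -> has_bidegree (lin_ext g x) e (m + 1).
Proof.
move=> gb x e m xem; rewrite /lin_ext big_seq.
elim/big_rec: _ => [|b y bx yem]; first exact: has_bidegree0.
apply: has_bidegree_lin => //; have [<- <-] := xem b bx; exact: gb.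
Qed.

Definition F0gen s j : F0 k := Sub (gen k s 1 j) (gen_F0 k s j).

Lemma F0_basisE (x : F0 k) :
  x = \sum_(b <- msupp (val x : {malg k[gen_index]}))
        (val x : {malg k[gen_index]})@_b *: F0gen (val b).1.1 (val b).2.
Proof.
apply: val_inj; apply: etrans (malg_basisE (val x)) _; rewrite raddf_sum.
apply: eq_big_seq => b bx.
rewrite [RHS]linearZ /=; congr (_ *: _).
by have /allP/(_ b bx)/eqP b1 := valP x; rewrite -gen_val b1.
Qed.

(** Membership in classes is linear, so generators suffice; those with [j <= 0] are zero in [F0],
    since [1 + j < 2]. *)
Lemma in_class_F0 (d : CV) (a : {linear F0 k -> H d})
    (alpha : {linear F k -> CV}) :
    (forall s (j : nat), (0 < j)%N ->
       in_class (alpha (gen k s 1 j)) (a (F0gen s j))) ->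
  forall x : F0 k, in_class (alpha (val x)) (a x).
Proof.
move=> aj x; rewrite [x]F0_basisE; move: (msupp _) => r.
elim/big_rec: _ => [|b y _ yc]; first by rewrite !raddf0; exact: in_class0.
rewrite !linearP; apply: in_class_lin => //.
have class_le0 s (j : int) :
    j <= 0 -> in_class (alpha (val (F0gen s j))) (a (F0gen s j)).
  move=> j0; have -> : F0gen s j = 0.
    by apply: val_inj; rewrite /= /gen insubF //= /is_index; lia.
  by rewrite !raddf0; exact: in_class0.
move: (val b).1.1 (val b).2 => s [j|j]; last exact: class_le0.
by have [->|j0] := posnP j; [exact: class_le0|exact: aj].
Qed.

End MasseyMap.

(** * Passing between deformations and Massey maps *)

Lemma addTb_odd m : (0 < m)%N -> true (+) odd m = odd m.-1.
Proof. by case: m => //= m _; rewrite negbK. Qed.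

Theorem mainTheorem3 (kd : infty_kind) (k : fieldType)
    (char_k : 2%N \notin [pchar k])
    (V : bool -> lmodType k) (d : C kd V)
    (d_infty : infty_structure d) (d_quadratic : quadratic d)
    (c b : nat -> H d)
    (c_bideg : forall i, (0 < i)%N -> class_bidegree (c i) (odd i) (i%:Z - 1))
    (b_bideg : forall i, (0 < i)%N -> class_bidegree (b i) (odd i.-1) (i%:Z - 1))
    (a : {linear F0 k -> H d})
    (a_e : forall j, (0 < j)%N -> a (F0e k j%:Z) = c j)
    (a_f : forall j, (0 < j)%N -> a (F0f k j%:Z) = b j) :
  (exists (gamma beta : nat -> C kd V) (phi psi : nat -> nat -> C kd V),
      formal_deformation d gamma beta phi psi /\
      (forall i, (0 < i)%N ->
        in_class (phi 1%N i) (c i) /\ in_class (psi 1%N i) (b i)))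
  <-> massey_trivial a.
Proof.
split.
  case=> gamma [beta [phi [psi [[g0 b0 gs bs phib psib def] cls]]]].
  pose G (s : bool) := if s then beta else gamma.
  pose X (s : bool) := if s then psi else phi.
  have GX s i : is_sum (G s i) (X s i) by case: s.
  have Xb s i m : (0 < m)%N -> has_bidegree (X s i m) (s (+) odd m) (m%:Z - 1).
    case: s => [m0|]; last exact: phib.
    by rewrite addTb_odd //; exact: psib.
  (* Generators go to the components of the deformation, and to 0 for [j <= 0], where no cochains
     exist. *)
  pose g (x : gen_index) : C kd V :=
    let: (s, i, j) := val x in if j is Posz m.+1 then X s i m.+1 else 0.
  pose alpha : {linear F k -> C kd V} := lin_ext g.
  have g_bideg x : has_bidegree (g x) (index_degree x) (index_weight x + 1).
    case: x => [[[s i] [[|m]|m]] xi]; rewrite /g /index_degree /index_weight //=.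
    have -> : m.+1%:Z - 2 + 1 = m.+1%:Z - 1 by lia.
    exact: Xb.
  have alpha_bideg : forall x e m,
      F_bidegree x e m -> has_bidegree (alpha x) e (m + 1).
    exact: lin_ext_bidegree.
  have alpha_gen s i m : (0 < i)%N -> (0 < m)%N ->
      alpha (gen k s i m%:Z) = X s i m.
    case: m => // m i0 _; rewrite /gen; case: insubP => [x _ vx|].
      by rewrite /alpha /= lin_extU /g vx.
    by rewrite /is_index; lia.
  have G_alpha s i e v : (0 < i)%N ->
      cval (G s i) e v = cval (alpha (gen k s i (size v)%:Z)) e v.
    (* Length 0 is not covered by [alpha_gen], but all cochains vanish there. *)
    move=> i0; have [v0|v0] := posnP (size v).
      by rewrite !cochain_arity0.
    by rewrite alpha_gen // GX.
  exists alpha; split=> //.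
    apply/(massey_equation d_quadratic alpha_bideg G_alpha).
    apply/(mu_series_eq0 char_k d_infty g0 b0) => //.
    exact: (G_parity alpha_bideg G_alpha).
  apply: in_class_F0 => s j j0; rewrite alpha_gen //.
  have [cj bj] := cls j j0.
  by case: s; [rewrite (a_f j j0 : a (F0gen k true j) = b j)
              |rewrite (a_e j j0 : a (F0gen k false j) = c j)].
case=> alpha [alpha_bideg alpha_eq alpha_class].
(* Conversely, the components are read off from [alpha]; order zero has to be set by hand, with [d]
   alone in arity 2. *)
pose X (s : bool) i m : C kd V :=
  if i is 0%N then if ~~ s && (m == 2) then d else 0
  else alpha (gen k s i m%:Z).
pose G (s : bool) i : C kd V :=
  if i is 0%N then if s then 0 else d else cochain_sum (X s i).
have G_alpha s i e v : (0 < i)%N ->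
    cval (G s i) e v = cval (alpha (gen k s i (size v)%:Z)) e v.
  by case: i.
have GX s i : is_sum (G s i) (X s i).
  case: i => [|i]; last exact: cochain_sumP.
  by case: s => //; exact: is_sum_d.
have Xb s i m : (0 < m)%N -> has_bidegree (X s i m) (s (+) odd m) (m%:Z - 1).
  case: i => [|i] m0.
    rewrite /X; case: ifP => // /andP[/negPf-> /eqP->] e v ev.
    have [v2|v2] := eqVneq (size v) 2; last exact: d_quadratic.
    (* An odd cochain of arity 2 has even Z_2-degree. *)
    apply: (infty_structure_odd d_infty); rewrite v2 /parity.
    by move: ev; rewrite v2 andbT; case: e.
  have := alpha_bideg _ _ _ (@gen_bidegree k s i.+1 m).
  by have -> : m%:Z - 2 + 1 = m%:Z - 1 by lia.
exists (G false), (G true), (X false), (X true); split; last first.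
  move=> i i0; rewrite -(a_e i i0) -(a_f i i0).
  by split; [exact: (alpha_class (F0e k i))|exact: (alpha_class (F0f k i))].
split=> //.
- exact: Xb.
- by move=> i m m0; rewrite -addTb_odd //; exact: Xb.
apply/(mu_series_eq0 (G := G) char_k d_infty) => //.
  exact: (G_parity alpha_bideg G_alpha).
exact/(massey_equation d_quadratic alpha_bideg G_alpha).
Qed.
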